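(* Let $n\geq r\geq1$ and let $\{A_j\}_{j=1}^m$ be a frame of Hermitian $n\times n$ matrices for $\mathbb{C}^{n\times r}$. The following are equivalent: (i) $\{A_j\}$ is generalized phase retrievable. (ii) For all $U_1\in\mathbb{C}^{n\times r},U_2\in\mathbb{C}^{n\times(n-r)}$ with $[U_1|U_2]\in U(n)$, the matrix $Q_{[U_1|U_2]}=\sum_{j=1}^mv_jv_j^T$, $v_j=\begin{bmatrix}\tau(U_1^*A_jU_1)\\\mu(U_2^*A_jU_1)\end{bmatrix}$, is invertible. (iii) For all $z\in\mathbb{C}^{n\times r}$ with orthonormal columns, the matrix $\hat Q_z=4\sum_{j=1}^m(I_r\otimes j(A_j))\mu(z)\mu(z)^T(I_r\otimes j(A_j))$ has null space exactly the $r^2$-dimensional space $\mathcal{V}_z=\{\mu(zK):K\in\mathbb{C}^{r\times r},K^*=-K\}$. (iv) For all $U_1,U_2$ as in (ii), all Hermitian $H\in\mathbb{C}^{r\times r}$ and all $B\in\mathbb{C}^{(n-r)\times r}$, there exist $c_1,\dots,c_m\in\mathbb{R}$ with $U_1^*(\sum_jc_jA_j)U_1=H$ and $U_2^*(\sum_jc_jA_j)U_1=B$. (v) For all $U_1\in\mathbb{C}^{n\times r}$ with orthonormal columns, $\mathrm{span}_{\mathbb{R}}\{A_jU_1\}_{j=1}^m=\{U_1K:K\in\mathbb{C}^{r\times r},K^*=-K\}^\perp$, the orthogonal complement in $\mathbb{C}^{n\times r}$ with respect to $\langle X,Y\rangle_{\mathbb{R}}=\mathrm{Re}\,\mathrm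{tr}(X^*Y)$.
   Context: Frame: there are $0<A\le B$ with $A\|z\|_2^2\leq\sum_j\mathrm{Re}\,\mathrm{tr}(A_jzz^* )\leq B\|z\|_2^2$ for all $z\in\mathbb{C}^{n\times r}$. Generalized phase retrievable: the map $\beta(z)=(\mathrm{Re}\,\mathrm{tr}(A_jzz^* ))_{j=1}^m$ satisfies $\beta(x)=\beta(y)\Rightarrow xx^*=yy^*$ (i.e. is injective on $\mathbb{C}^{n\times r}/U(r)$). $\tau(X)=(X_{11},\dots,X_{rr},\sqrt2\,T(\mathrm{Re}X),\sqrt2\,T(\mathrm{Im}X))\in\mathbb{R}^{r^2}$ for Hermitian $r\times r$ $X$, where $T(Y)=(Y_{12},Y_{13},Y_{23},\dots,Y_{r-1,r})$; $\mu(X)=\mathrm{vec}\begin{bmatrix}\mathrm{Re}X\\\mathrm{Im}X\end{bmatrix}$ (column stacking) for complex $p\times q$ $X$; $j(X)=\begin{bmatrix}\mathrm{Re}X&-\mathrm{Im}X\\\mathrm{Im}X&\mathrm{Re}X\end{bmatrix}$. *)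

(* Defs.v *)
From mathcomp Require Import all_boot all_algebra.
From mathcomp Require Import reals complex mxtens.
Set Implicit Arguments. Unset Strict Implicit. Unset Printing Implicit Defensive.
Import GRing.Theory Num.Theory.
Local Open Scope ring_scope.

Section Defs.
Variable R : realType.
Local Notation C := R[i].

Definition adj {p q} (X : 'M[C]_(p, q)) : 'M[C]_(q, p) :=
  (map_mx (@conjc R) X)^T.

Definition is_hermitian {p} (X : 'M[C]_p) : Prop := adj X = X.
Definition skew_hermitian {p} (K : 'M[C]_p) : Prop := adj K = - K.

Definition ipR {p q} (X Y : 'M[C]_(p, q)) : R := complex.Re (\tr (adj X *m Y)).

Definition beta {m n r} (A : 'I_m -> 'M[C]_n) (z : 'M[C]_(n, r)) (j : 'I_m) : R :=
  complex.Re (\tr (A j *m z *m adj z)).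

Definition is_frame {m n} (r : nat) (A : 'I_m -> 'M[C]_n) : Prop :=
  exists a b : R, [/\ 0 < a, a <= b &
    forall z : 'M[C]_(n, r),
      a * ipR z z <= \sum_j beta A z j /\ \sum_j beta A z j <= b * ipR z z].

Definition gen_phase_retrievable {m n} (r : nat) (A : 'I_m -> 'M[C]_n) : Prop :=
  forall x y : 'M[C]_(n, r), (forall j, beta A x j = beta A y j) ->
    x *m adj x = y *m adj y.

Definition ReM {p q} (X : 'M[C]_(p, q)) : 'M[R]_(p, q) := map_mx (@complex.Re R) X.
Definition ImM {p q} (X : 'M[C]_(p, q)) : 'M[R]_(p, q) := map_mx (@complex.Im R) X.

(* mu(X) = vec [Re X; Im X] (column stacking) *)
Definition mu {p q} (X : 'M[C]_(p, q)) : 'cV[R]_(q * (p + p)) :=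
  (mxvec (col_mx (ReM X) (ImM X))^T)^T.

Definition jmat {p} (X : 'M[C]_p) : 'M[R]_(p + p) :=
  block_mx (ReM X) (- ImM X) (ImM X) (ReM X).

(* pairs (k,l), k < l, in the order (1,2),(1,3),(2,3),...,(r-1,r) *)
Definition upper_pairs (r : nat) : seq ('I_r * 'I_r) :=
  [seq (k, l) | l : 'I_r <- enum 'I_r, k : 'I_r <- [seq k : 'I_r <- enum 'I_r | (val k < val l)%N]].

Definition tau_seq {r} (X : 'M[C]_r) : seq R :=
  [seq complex.Re (X i i) | i <- enum 'I_r]
  ++ [seq Num.sqrt 2 * complex.Re (X kl.1 kl.2) | kl <- upper_pairs r]
  ++ [seq Num.sqrt 2 * complex.Im (X kl.1 kl.2) | kl <- upper_pairs r].

Definition tau {r} (X : 'M[C]_r) : 'cV[R]_(r * r) :=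
  \col_(i < r * r) nth 0 (tau_seq X) i.

Definition unitary_pair {n r} (U1 : 'M[C]_(n, r)) (U2 : 'M[C]_(n, n - r)) : Prop :=
  adj (row_mx U1 U2) *m row_mx U1 U2 = 1%:M /\
  row_mx U1 U2 *m adj (row_mx U1 U2) = 1%:M.

Definition Qmat {m n r} (A : 'I_m -> 'M[C]_n)
  (U1 : 'M[C]_(n, r)) (U2 : 'M[C]_(n, n - r)) :=
  \sum_j (col_mx (tau (adj U1 *m A j *m U1)) (mu (adj U2 *m A j *m U1))
          *m (col_mx (tau (adj U1 *m A j *m U1)) (mu (adj U2 *m A j *m U1)))^T).

Definition hatQ {m n r} (A : 'I_m -> 'M[C]_n) (z : 'M[C]_(n, r)) : 'M[R]_(r * (n + n)) :=
  (4 : R) *: \sum_j ((1%:M : 'M[R]_r) *t jmat (A j) *m mu z *m (mu z)^T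
                     *m ((1%:M : 'M[R]_r) *t jmat (A j))).

Definition rC (x : R) : C := (x%:C)%C.

End Defs.

(* Main.v *)
(* Every condition is compared with one statement, [kernel_vertical]: if [z] has
   orthonormal columns and [Re tr((A_j z)^* w) = 0] for all [j], then [w = z K]
   with [K] skew-Hermitian. (ii)-(v) are linear algebra around it: (ii) and (iii)
   are Gram matrices of the vectors [A_j z], written in coordinates, while (iv)
   and (v) are the dual statements about their real span.
   For (i), with [x = u + v] and [y = u - v] one has [beta x - beta y =
   4 Re tr((A_j u)^* v)] and [x x^* - y y^* = 2 u v^* + 2 v u^* ]. Only [u v^*]
   matters, and it can be refactored as [z w^*] with [z] of full rank [r], hence
   with [z = U P], [U] orthonormal and [P] invertible, which reduces arbitrary
   pairs [x, y] to the orthonormal case. *)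
From mathcomp Require Import all_boot all_order all_algebra.
From mathcomp Require Import reals complex mxtens spectral.
From mathcomp Require Import zify ring lra.
Import Order.TTheory GRing.Theory Num.Theory.
(* Imported last: [Num.Theory] has its own [ReM] and [ImM]. *)
Require Import Defs.
Set Implicit Arguments. Unset Strict Implicit. Unset Printing Implicit Defensive.
Local Open Scope ring_scope.

(** * Adjoints and the real inner product on complex matrices *)

Section Adjoint.
Variable R : realType.
Local Notation C := R[i].

Lemma adjK p q (X : 'M[C]_(p, q)) : adj (adj X) = X.
Proof. by apply/matrixP => i j; rewrite !mxE conjcK. Qed.

Lemma adjM p q s (X : 'M[C]_(p, q)) (Y : 'M[C]_(q, s)) :
  adj (X *m Y) = adj Y *m adj X.
Proof. by rewrite /adj map_mxM trmx_mul. Qed.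

Lemma adjD p q (X Y : 'M[C]_(p, q)) : adj (X + Y) = adj X + adj Y.
Proof. by rewrite /adj map_mxD raddfD. Qed.

Lemma adjN p q (X : 'M[C]_(p, q)) : adj (- X) = - adj X.
Proof. by rewrite /adj map_mxN raddfN. Qed.

Lemma adj_rCZ p q (a : R) (X : 'M[C]_(p, q)) : adj (rC a *: X) = rC a *: adj X.
Proof. by apply/matrixP => i j; rewrite !mxE rmorphM /= oppr0. Qed.

Lemma adj_row p q1 q2 (X : 'M[C]_(p, q1)) (Y : 'M[C]_(p, q2)) :
  adj (row_mx X Y) = col_mx (adj X) (adj Y).
Proof. by rewrite /adj map_row_mx tr_row_mx. Qed.

Lemma hermitian_congr n r (A : 'M[C]_n) (U : 'M[C]_(n, r)) :
  is_hermitian A -> is_hermitian (adj U *m A *m U).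
Proof. by rewrite /is_hermitian => hA; rewrite !adjM adjK hA mulmxA. Qed.

Lemma Re_conjc (x : C) : complex.Re x^*%C = complex.Re x.
Proof. by case: x. Qed.

Lemma ReD (x y : C) : complex.Re (x + y) = complex.Re x + complex.Re y.
Proof. by case: x y => [a b] [c d]. Qed.

Lemma ReN (x : C) : complex.Re (- x) = - complex.Re x.
Proof. by case: x. Qed.

Lemma Re_rCM (a : R) (x : C) : complex.Re (rC a * x) = a * complex.Re x.
Proof. by case: x => [c d] /=; rewrite mul0r subr0. Qed.

Lemma Re_sum (I : Type) (s : seq I) (P : pred I) (F : I -> C) :
  complex.Re (\sum_(i <- s | P i) F i) = \sum_(i <- s | P i) complex.Re (F i).
Proof. exact: (big_morph _ ReD). Qed.

Lemma Re_conjMl (x y : C) : complex.Re (x^*%C * y) =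
  complex.Re x * complex.Re y + complex.Im x * complex.Im y.
Proof. by case: x y => [a b] [c d] /=; rewrite mulNr opprK. Qed.

Lemma Re_tr_adj n (X : 'M[C]_n) : complex.Re (\tr (adj X)) = complex.Re (\tr X).
Proof.
rewrite /mxtrace !Re_sum; apply: eq_bigr => i _; by rewrite !mxE Re_conjc.
Qed.

Lemma ipRE p q (X Y : 'M[C]_(p, q)) : ipR X Y = \sum_i \sum_j
  (complex.Re (X i j) * complex.Re (Y i j) + complex.Im (X i j) * complex.Im (Y i j)).
Proof.
rewrite /ipR /mxtrace Re_sum exchange_big; apply: eq_bigr => j _ /=.
rewrite mxE Re_sum; apply: eq_bigr => i _; by rewrite !mxE Re_conjMl.
Qed.

Lemma ipRC p q (X Y : 'M[C]_(p, q)) : ipR X Y = ipR Y X.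
Proof.
rewrite !ipRE; apply: eq_bigr => i _; apply: eq_bigr => j _.
by rewrite mulrC [X in _ + X]mulrC.
Qed.

Lemma ipRDr p q (X Y Z : 'M[C]_(p, q)) : ipR X (Y + Z) = ipR X Y + ipR X Z.
Proof. by rewrite /ipR mulmxDr raddfD /= ReD. Qed.

Lemma ipRNr p q (X Y : 'M[C]_(p, q)) : ipR X (- Y) = - ipR X Y.
Proof. by rewrite /ipR mulmxN raddfN /= ReN. Qed.

Lemma ipRDl p q (X Y Z : 'M[C]_(p, q)) : ipR (X + Y) Z = ipR X Z + ipR Y Z.
Proof. by rewrite ipRC ipRDr !(ipRC Z). Qed.

Lemma ipRNl p q (X Y : 'M[C]_(p, q)) : ipR (- X) Y = - ipR X Y.
Proof. by rewrite ipRC ipRNr ipRC. Qed.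

Lemma ipRZl p q (a : R) (X Y : 'M[C]_(p, q)) : ipR (rC a *: X) Y = a * ipR X Y.
Proof. by rewrite /ipR adj_rCZ -scalemxAl linearZ /= Re_rCM. Qed.

Lemma ipR0l p q (X : 'M[C]_(p, q)) : ipR 0 X = 0.
Proof. by rewrite ipRC /ipR mulmx0 linear0. Qed.

Lemma ipR_suml p q (I : Type) (s : seq I) (P : pred I) (F : I -> 'M[C]_(p, q)) Y :
  ipR (\sum_(i <- s | P i) F i) Y = \sum_(i <- s | P i) ipR (F i) Y.
Proof.
apply: (big_morph (fun X => ipR X Y)); last exact: ipR0l.
by move=> X Z; rewrite ipRDl.
Qed.

Lemma ipR_eq0 p q (X : 'M[C]_(p, q)) : ipR X X = 0 -> X = 0.
Proof.
have sq_ge0 i j : 0 <= complex.Re (X i j) * complex.Re (X i j) +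
    complex.Im (X i j) * complex.Im (X i j).
  by rewrite addr_ge0 // -expr2 sqr_ge0.
rewrite ipRE => /eqP; rewrite psumr_eq0; last by move=> i _; exact: sumr_ge0.
move=> /allP h; apply/matrixP => i j; rewrite mxE.
move: (h i (mem_index_enum _)) => /=; rewrite psumr_eq0 //.
move=> /allP /(_ j (mem_index_enum _)) /=.
rewrite paddr_eq0 -?expr2 ?sqr_ge0 // !sqrf_eq0.
by case: (X i j) => a b /= /andP[/eqP -> /eqP ->].
Qed.

Lemma ipR_adjl p q s (Z : 'M[C]_(p, q)) (X : 'M[C]_(q, s)) Y :
  ipR (Z *m X) Y = ipR X (adj Z *m Y).
Proof. by rewrite /ipR adjM mulmxA. Qed.

Lemma ipR_adjr p q s (X : 'M[C]_(p, q)) (Y : 'M[C]_(p, s)) P :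
  ipR X (Y *m P) = ipR (X *m adj P) Y.
Proof. by rewrite /ipR adjM adjK mulmxA mxtrace_mulC mulmxA. Qed.

(** Taking the adjoint inside the trace preserves its real part, while [adj K = - K] and cyclicity
    turn the result into the negative of the original. *)
Lemma ipR_herm_skew r (H K : 'M[C]_r) :
  is_hermitian H -> skew_hermitian K -> ipR H K = 0.
Proof.
move=> hH hK; have : ipR H K = - ipR H K.
  by rewrite {1}/ipR -Re_tr_adj adjM adjK hK mulNmx linearN /= ReN mxtrace_mulC /ipR hH.
by move=> h; lra.
Qed.

(** The easy half of every kernel computation: moving [z] across pairs the Hermitian matrix
    [adj z *m A *m z] with [K]. *)
Lemma ipR_vertical n r (A : 'M[C]_n) (z : 'M[C]_(n, r)) K :
  is_hermitian A -> skew_hermitian K -> ipR (A *m z) (z *m K) = 0.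
Proof.
move=> hA hK; rewrite ipRC ipR_adjl mulmxA ipRC; apply: ipR_herm_skew => //.
exact: hermitian_congr.
Qed.

Definition herm_part r (X : 'M[C]_r) : 'M[C]_r := rC 2^-1 *: (X + adj X).
Definition skew_part r (X : 'M[C]_r) : 'M[C]_r := rC 2^-1 *: (X - adj X).

Lemma rC_half_add p q (X : 'M[C]_(p, q)) : rC 2^-1 *: (X + X) = X.
Proof.
apply/matrixP => i j; rewrite !mxE; case: (X i j) => a b.
by apply/eqP; rewrite eq_complex /=; apply/andP; split; apply/eqP; lra.
Qed.

Lemma herm_partP r (X : 'M[C]_r) : is_hermitian (herm_part X).
Proof. by rewrite /is_hermitian adj_rCZ adjD adjK addrC. Qed.

Lemma skew_partP r (X : 'M[C]_r) : skew_hermitian (skew_part X).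
Proof. by rewrite /skew_hermitian adj_rCZ adjD adjN adjK -scalerN opprB. Qed.

Lemma herm_skew_part r (X : 'M[C]_r) : herm_part X + skew_part X = X.
Proof. by rewrite -scalerDr addrACA subrr addr0 rC_half_add. Qed.

(** * Orthonormalization, unitary completion and rank factorization *)

Lemma mulmx1_comm p q (P : 'M[C]_(p, q)) (Q : 'M[C]_(q, p)) :
  p = q -> P *m Q = 1%:M -> Q *m P = 1%:M.
Proof. by move=> e; case: q / e in P Q * => /mulmx1C. Qed.

Lemma unitarymx_adjP p q (V : 'M[C]_(p, q)) :
  reflect (V *m adj V = 1%:M) (V \is unitarymx).
Proof.
suff -> : adj V = map_mx Num.conj V^T by exact: unitarymxP.
by rewrite /adj map_trmx.
Qed.

(** A QR factorization: Gram-Schmidt works on rows, so it is applied to [adj z]. The triangular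
    factor is invertible because its rank is at least that of [z]. *)
Lemma unitary_factor n r (z : 'M[C]_(n, r)) : (r <= n)%N -> \rank z = r ->
  exists U P, [/\ adj U *m U = 1%:M, P \in unitmx & z = U *m P :> 'M[C]_(n, r)].
Proof.
move=> hrn rz; have /submxP[P eP] := schmidt_sub (adj z).
have /unitarymx_adjP := @schmidt_unitarymx _ _ _ (adj z) hrn.
move: (schmidt (adj z)) eP => S eP SS.
have ez : z = adj S *m adj P by rewrite -adjM -eP adjK.
exists (adj S), (adj P); split; rewrite ?adjK //.
rewrite -row_full_unit -col_leq_rank -{1}rz {1}ez mxrankM_maxr //.
Qed.

Lemma unitary_complete n r (U : 'M[C]_(n, r)) : adj U *m U = 1%:M ->
  exists U' : 'M[C]_(n, n - r), unitary_pair U U'.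
Proof.
move=> UU; have Vu : adj U \is unitarymx by apply/unitarymx_adjP; rewrite adjK.
have rV := mxrank_unitary Vu.
have [B []] : exists B : 'M[C]_(n - r, n), B \is unitarymx /\ adj U *m adj B = 0.
  pose V' := orthomx (@Num.conj C) (mx_of_hermitian (hermitian1mx n)) (adj U).
  (* Writing [n - r] as the rank of the orthogonal complement [V'] gives [row_base V'] the required
     number of rows. *)
  have <- : \rank V' = (n - r)%N by rewrite /V' rank_ortho rV.
  exists (schmidt (row_base V')); split.
    by rewrite schmidt_unitarymx ?rank_leq_col.
  have : adj U *m map_mx Num.conj (schmidt (row_base V'))^T = 0.
    apply/orthomx1P; rewrite orthomx_sym.
    by rewrite eqmx_schmidt_free ?eq_row_base ?row_base_free.
  by rewrite -map_trmx.
move=> /unitarymx_adjP BB UB; exists (adj B).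
have hrn : (r + (n - r) = n)%N.
  by rewrite subnKC // -rV rank_leq_col.
have BU : B *m U = 0 by rewrite -[LHS]adjK adjM UB /adj map_mx0 trmx0.
have e : adj (row_mx U (adj B)) *m row_mx U (adj B) = 1%:M.
  by rewrite adj_row adjK mul_col_row UU UB BB BU -scalar_mx_block.
(* The dimensions [r + (n - r)] and [n] agree only propositionally, so the left inverse becomes a
   right inverse through an explicit equality. *)
by split=> //; exact: mulmx1_comm e.
Qed.

(** In [u = L D R] with [D = pid_mx (\rank u)], split [D] as [pid_mx r *m D]. The left factor
    [L *m pid_mx r] has full rank, and the rank defect of [u] is absorbed into [w]. *)
Lemma full_rank_cofactor n r (u v : 'M[C]_(n, r)) : (r <= n)%N ->
  exists z w : 'M[C]_(n, r), \rank z = r /\ u *m adj v = z *m adj w.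
Proof.
move=> hrn; exists (col_ebase u *m pid_mx r).
exists (v *m adj ((pid_mx (\rank u) : 'M_r) *m row_ebase u)); split.
  by rewrite eqmxMfull ?rank_pid_mx // row_full_unit col_ebase_unit.
rewrite -{1}(mulmx_ebase u).
have le_ur : (\rank u <= r)%N by exact: rank_leq_col.
have -> : pid_mx (\rank u) = (pid_mx r : 'M_(n, r)) *m pid_mx (\rank u) :> 'M[C]_(n, r).
  by rewrite mul_pid_mx (minn_idPr le_ur) (minn_idPr le_ur).
by rewrite !adjM !adjK !mulmxA.
Qed.
End Adjoint.

(** * Real coordinates [mu], Kronecker products and real spans *)

Lemma index_allpairs_pair (S T : eqType) (s : seq S) (t : seq T) x y :
  x \in s -> y \in t ->
  index (x, y) [seq (x, y) | x <- s, y <- t] = (index x s * size t + index y t)%N.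
Proof.
move=> + yt; elim: s => //= a s IH; rewrite inE index_cat eq_sym.
case: (eqVneq x a) => [-> _|xa /= xs].
  by rewrite map_f // mul0n add0n index_map // => u v [].
rewrite (_ : _ \in _ = false) ?IH // ?size_map ?mulSn ?addnA //.
by apply/mapP => -[v _ [e]]; rewrite e eqxx in xa.
Qed.

(** Both numberings of pairs are row-major, [i * n + j]; hence the Kronecker product in (iii) can
    act on vectors stacked by [mxvec]. *)
Lemma mxvec_index_mxtens m n (i : 'I_m) (j : 'I_n) :
  mxvec_index i j = mxtens_index (i, j).
Proof.
apply: val_inj => /=; rewrite /enum_rank [enum_rank_in]unlock insubdK.
  rewrite enumT unlock /= /prod_enum index_allpairs_pair ?mem_enum //.
  by rewrite size_enum_ord !index_enum_ord.
by rewrite -[_ \in _]/(_ < _)%N cardE index_mem mem_enum.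
Qed.

Section Vectorization.
Variable R : realType.
Local Notation C := R[i].

Lemma muE p q (X : 'M[C]_(p, q)) j s :
  mu X (mxvec_index j s) 0 = col_mx (ReM X) (ImM X) s j.
Proof. by rewrite mxE mxvecE mxE. Qed.

Lemma sum_mxvec_index p q (F : 'I_(p * q) -> R) :
  \sum_k F k = \sum_i \sum_j F (mxvec_index i j).
Proof.
by rewrite pair_big (reindex _ (curry_mxvec_bij p q)) /=; apply: eq_bigr => -[].
Qed.

Lemma mu_dot p q (X Y : 'M[C]_(p, q)) : ((mu X)^T *m mu Y) 0 0 = ipR X Y.
Proof.
rewrite mxE sum_mxvec_index ipRE [RHS]exchange_big; apply: eq_bigr => j _ /=.
rewrite big_split_ord /= -big_split; apply: eq_bigr => i _ /=.
by rewrite ![(mu X)^T _ _]mxE !muE !col_mxEu !col_mxEd !mxE.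
Qed.

Lemma mu_surj p q (x : 'cV[R]_(q * (p + p))) : exists X : 'M[C]_(p, q), mu X = x.
Proof.
exists (\matrix_(i, j) (Complex (x (mxvec_index j (lshift p i)) 0)
                                (x (mxvec_index j (rshift p i)) 0))).
apply/colP => k; case/mxvec_indexP: k => j s; rewrite muE -(splitK s).
by case: (split s) => i /=; rewrite ?col_mxEu ?col_mxEd !mxE.
Qed.

Lemma mu0 p q : mu (0 : 'M[C]_(p, q)) = 0.
Proof.
apply/colP => k; case/mxvec_indexP: k => j s; rewrite muE -(splitK s).
by case: (split s) => i /=; rewrite ?col_mxEu ?col_mxEd !mxE.
Qed.

Lemma mu_inj p q : injective (@mu R p q).
Proof.
move=> X Y eXY; apply/matrixP => i j.
have := congr1 (fun x : 'cV_ _ => x (mxvec_index j (lshift p i)) 0) eXY.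
have := congr1 (fun x : 'cV_ _ => x (mxvec_index j (rshift p i)) 0) eXY.
rewrite !muE !col_mxEu !col_mxEd !mxE.
by case: (X i j) (Y i j) => a b [c d] /= -> ->.
Qed.

Lemma ReM_mul p q s (X : 'M[C]_(p, q)) (Y : 'M[C]_(q, s)) :
  ReM (X *m Y) = ReM X *m ReM Y - ImM X *m ImM Y.
Proof.
apply/matrixP => i j; rewrite !mxE Re_sum -sumrB; apply: eq_bigr => k _.
by rewrite !mxE; case: (X i k) (Y k j) => a b [c d].
Qed.

Lemma ImM_mul p q s (X : 'M[C]_(p, q)) (Y : 'M[C]_(q, s)) :
  ImM (X *m Y) = ImM X *m ReM Y + ReM X *m ImM Y.
Proof.
have ImD (x y : C) : complex.Im (x + y) = complex.Im x + complex.Im y.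
  by case: x y => [a b] [c d].
apply/matrixP => i j; rewrite !mxE (big_morph _ ImD (erefl _)) -big_split.
apply: eq_bigr => k _; rewrite !mxE.
by case: (X i k) (Y k j) => a b [c d] /=; rewrite addrC.
Qed.

Lemma jmat_col p q (A : 'M[C]_p) (z : 'M[C]_(p, q)) :
  jmat A *m col_mx (ReM z) (ImM z) = col_mx (ReM (A *m z)) (ImM (A *m z)).
Proof. by rewrite mul_block_col ReM_mul ImM_mul mulNmx. Qed.

(** The Kronecker product is block diagonal with one copy of [jmat A] per column of [z], and
    [jmat A] is the real form of multiplication by [A]. *)
Lemma tens1_jmat_mu p q (A : 'M[C]_p) (z : 'M[C]_(p, q)) :
  ((1%:M : 'M[R]_q) *t jmat A) *m mu z = mu (A *m z).
Proof.
apply/colP => k; case/mxvec_indexP: k => j s.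
rewrite muE -jmat_col !mxE sum_mxvec_index (bigD1 j) //= [X in _ + X]big1 ?addr0.
  apply: eq_bigr => t _; rewrite muE !mxvec_index_mxtens tensmxE.
  by rewrite !mxE eqxx mul1r.
move=> i ne_ij; apply: big1 => t _; rewrite !mxvec_index_mxtens tensmxE.
by rewrite !mxE eq_sym (negPf ne_ij) !mul0r.
Qed.

Lemma jmat_herm p (A : 'M[C]_p) : is_hermitian A -> (jmat A)^T = jmat A.
Proof.
move=> hA; have e i j : A j i = ((A i j)^*)%C by rewrite -{1}hA !mxE.
rewrite /jmat tr_block_mx; congr block_mx; apply/matrixP => i j; rewrite !mxE e;
  by case: (A i j) => a b /=; rewrite ?opprK.
Qed.

(** Finite-dimensional double orthogonality. The columns of [cokermx M] encode matrices orthogonal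
    to every [Y j], so [mu X] is killed by them and lies in the row space of [M]. *)
Lemma span_double_orthogonal m p q (Y : 'I_m -> 'M[C]_(p, q)) X :
  (forall w, (forall j, ipR (Y j) w = 0) -> ipR X w = 0) ->
  exists c : 'I_m -> R, X = \sum_j rC (c j) *: Y j.
Proof.
move=> h; pose M := \matrix_(j < m) (mu (Y j))^T.
have /submxP[D eD] : ((mu X)^T <= M)%MS.
  rewrite submxE; apply/eqP/matrixP => i k; rewrite (ord1 i).
  have [w ew] := mu_surj (col k (cokermx M)).
  have -> : ((mu X)^T *m cokermx M) 0 k = ipR X w.
    by rewrite -mu_dot ew [LHS]mxE [RHS]mxE; apply: eq_bigr => l _; rewrite [col _ _ _ _]mxE.
  rewrite mxE; apply: h => j; rewrite -mu_dot ew.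
  have := congr1 (fun Z : 'M_(_, _) => Z j k) (mulmx_coker M).
  rewrite [_ *m _]lock /= [RHS]mxE -lock => <-; rewrite [LHS]mxE [RHS]mxE.
  by apply: eq_bigr => l _; rewrite [col _ _ _ _]mxE [M _ _]mxE.
exists (fun j => D 0 j); apply: mu_inj; apply: trmx_inj; rewrite eD.
apply/rowP => k; case/mxvec_indexP: k => i s.
rewrite [RHS]mxE muE -(splitK s) [LHS]mxE.
(* Stated for any real-linear [F], so that it serves both the real and the imaginary halves of
   [mu]. *)
have eC (F : C -> R) : {morph F : x y / x + y} -> F 0 = 0 ->
    (forall a x, F (rC a * x) = a * F x) ->
    forall k, F ((\sum_j rC (D 0 j) *: Y j) k i) = \sum_j D 0 j * F (Y j k i).
  move=> FD F0 FZ k; rewrite summxE (big_morph _ FD F0); apply: eq_bigr => j _.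
  by rewrite mxE FZ.
case: (split s) => k; rewrite ?col_mxEu ?col_mxEd [RHS]mxE eC //=.
- by apply: eq_bigr => j _; rewrite [M _ _]mxE [(mu _)^T _ _]mxE muE col_mxEu mxE.
- exact: ReD.
- exact: Re_rCM.
- by apply: eq_bigr => j _; rewrite [M _ _]mxE [(mu _)^T _ _]mxE muE col_mxEd mxE.
- by move=> [a b] [c d].
- by move=> a [x y] /=; rewrite mul0r addr0.
Qed.


End Vectorization.

(** * Hermitian matrices in the real coordinates [tau] *)

Lemma size_upper_pairs r : size (upper_pairs r) = 'C(r, 2).
Proof.
rewrite size_allpairs_dep sumnE big_map big_enum /=.
rewrite -bin2_sum big_mkord; apply: eq_bigr => l _.
rewrite size_filter -sum1_count big_enum_cond /=.
by rewrite (big_ord_narrow (ltnW (ltn_ord l))) sum1_card card_ord.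
Qed.

Lemma mem_upper_pairs r (k l : 'I_r) : ((k, l) \in upper_pairs r) = (k < l)%N.
Proof.
apply/allpairsPdep/idP => [[l' [k' [_ + [-> ->]]]]|lt_kl].
  by rewrite mem_filter => /andP[].
by exists l, k; split; rewrite ?mem_enum // mem_filter lt_kl mem_enum.
Qed.

Lemma uniq_upper_pairs r : uniq (upper_pairs r).
Proof.
apply: allpairs_uniq_dep => [|l _|]; [exact: enum_uniq| |].
  exact/filter_uniq/enum_uniq.
by move=> [l k] [l' k'] _ _ [<- <-].
Qed.

Lemma square_bin2 r : (r * r = r + ('C(r, 2) + 'C(r, 2)))%N.
Proof. by elim: r => // r IH; rewrite binS bin1; lia. Qed.

(** Used to read back a prescribed list of coordinates from a matrix filled in along the enumeration
    [e]. *)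
Lemma map_nth_index (T : eqType) (S : Type) (x0 : S) (e : seq T) (s : seq S) :
  uniq e -> size s = size e -> [seq nth x0 s (index a e) | a <- e] = s.
Proof.
case: e => [_ /size0nil -> //|a0 e'] ue es; set e := a0 :: e' in ue es *.
apply: (@eq_from_nth _ x0); rewrite size_map // => i hi.
by rewrite (nth_map a0) // index_uniq.
Qed.

Section Tau.
Variable R : realType.
Local Notation C := R[i].

Lemma size_tau_seq r (X : 'M[C]_r) : size (tau_seq X) = (r * r)%N.
Proof.
rewrite 2!size_cat square_bin2 -size_upper_pairs.
congr (_ + (_ + _))%N; rewrite size_map ?size_enum_ord //.
Qed.

Lemma tau_surj r (t : 'cV[R]_(r * r)) :
  exists H : 'M[C]_r, is_hermitian H /\ tau H = t.
Proof.
pose N := 'C(r, 2).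
pose s := mkseq (fun i => if insub i is Some k then t k 0 else 0) (r * r).
have ss : size s = (r * r)%N by rewrite size_mkseq.
(* The three blocks prescribe the diagonal, then the real and imaginary parts above it; Hermitian
   symmetry forces the rest. *)
pose s1 := take r s; pose s2 := take N (drop r s); pose s3 := drop N (drop r s).
have es : s = s1 ++ s2 ++ s3 by rewrite !cat_take_drop.
have [ss1 ss2 ss3] : [/\ size s1 = r, size s2 = N & size s3 = N].
  rewrite /s1 /s2 /s3 !(size_take_min, size_drop) ss square_bin2 -/N.
  by split; lia.
pose U := upper_pairs r; have uU : uniq U := uniq_upper_pairs r.
pose entry k l : C := Complex (nth 0 s2 (index (k, l) U) / Num.sqrt 2)
                              (nth 0 s3 (index (k, l) U) / Num.sqrt 2).
pose H : 'M[C]_r := \matrix_(k, l)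
  if (k < l)%N then entry k l
  else if (l < k)%N then ((entry l k)^*)%C else rC (nth 0 s1 k).
have sqrt2 : Num.sqrt 2 != 0 :> R by rewrite sqrtr_eq0 -ltNge ltr0n.
exists H; split.
  apply/matrixP => k l; rewrite !mxE.
  by case: (ltngtP k l) => [||e]; rewrite ?conjcK // (val_inj e) /= oppr0.
suff eH : tau_seq H = s.
  apply/colP => i; rewrite mxE eH nth_mkseq //.
  by rewrite insubT //= => lt_i; congr (t _ _); apply: val_inj.
rewrite es; congr (_ ++ (_ ++ _)).
- rewrite -[RHS](@map_nth_index _ _ 0 (enum 'I_r)) ?enum_uniq ?size_enum_ord //.
  by apply: eq_map => i; rewrite mxE ltnn /= index_enum_ord.
- rewrite -[RHS](@map_nth_index _ _ 0 U) ?size_upper_pairs //.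
  by apply/eq_in_map => -[k l]; rewrite mem_upper_pairs mxE /= => -> /=; rewrite mulrC divfK.
- rewrite -[RHS](@map_nth_index _ _ 0 U) ?size_upper_pairs //.
  by apply/eq_in_map => -[k l]; rewrite mem_upper_pairs mxE /= => -> /=; rewrite mulrC divfK.
Qed.

Lemma sum_nth_zip (s t : seq R) N : size s = N -> size t = N ->
  \sum_(i < N) nth 0 s i * nth 0 t i = \sum_(xy <- zip s t) xy.1 * xy.2.
Proof.
move=> ss st; rewrite (big_nth (0, 0)) size_zip ss st minnn big_mkord.
by apply: eq_bigr => i _; rewrite nth_zip ?ss ?st.
Qed.

Lemma sum_upper_pairs r (f : 'I_r -> 'I_r -> R) :
  \sum_(kl <- upper_pairs r) f kl.1 kl.2 = \sum_(l < r) \sum_(k < r | (k < l)%N) f k l.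
Proof.
rewrite big_allpairs_dep big_enum /=; apply: eq_bigr => l _.
by rewrite big_filter big_enum_cond.
Qed.

Lemma sum_upper_symmetric r (f : 'I_r -> 'I_r -> R) : (forall k l, f k l = f l k) ->
  \sum_k \sum_l f k l =
  \sum_k f k k + 2 * \sum_(kl <- upper_pairs r) f kl.1 kl.2.
Proof.
move=> fC; rewrite sum_upper_pairs mulr_natl mulr2n addrA.
rewrite [X in _ + X](eq_bigr (fun l : 'I_r => \sum_(k < r | (k < l)%N) f l k)); last first.
  by move=> l _; apply: eq_bigr.
rewrite [X in _ + X + _](exchange_big_dep xpredT) //= -!big_split.
apply: eq_bigr => k _ /=; rewrite (bigD1 k) //= -addrA; congr (_ + _).
rewrite (bigID (fun l : 'I_r => (k < l)%N)) /=; congr (_ + _); apply: eq_bigl => l.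
  by rewrite -val_eqE /=; case: ltngtP.
by rewrite -val_eqE /=; case: ltngtP.
Qed.

(** The two factors [Num.sqrt 2] multiply to 2, which accounts for the lower triangle repeating the
    upper one; diagonal entries have no imaginary part. *)
Lemma tau_dot r (H K : 'M[C]_r) : is_hermitian H -> is_hermitian K ->
  ((tau H)^T *m tau K) 0 0 = ipR H K.
Proof.
move=> hH hK; pose f k l : R :=
  complex.Re (H k l) * complex.Re (K k l) + complex.Im (H k l) * complex.Im (K k l).
have adjE (X : 'M[C]_r) k l : is_hermitian X -> X k l = ((X l k)^*)%C.
  by move=> hX; rewrite -{1}hX !mxE.
have fC k l : f k l = f l k.
  rewrite /f (adjE H l) // (adjE K l) //; case: (H k l) (K k l) => a b [c d] /=.
  by rewrite mulrNN.
have diag0 (X : 'M[C]_r) k : is_hermitian X -> complex.Im (X k k) = 0.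
  move=> /(adjE X k k); case: (X k k) => a b [] /=; lra.
rewrite ipRE (sum_upper_symmetric fC) mxE.
under eq_bigr do rewrite ![_^T _ _]mxE ![tau _ _ _]mxE.
rewrite sum_nth_zip ?size_tau_seq // !zip_cat ?size_map // !zip_map.
rewrite 2!big_cat; congr (_ + _).
  by rewrite big_map big_enum /=; apply: eq_bigr => i _; rewrite /f !diag0 // mul0r addr0.
rewrite /= 2!big_map -big_split mulr_sumr; apply: eq_bigr => kl _ /=.
have sq : Num.sqrt 2 * Num.sqrt 2 = 2 :> R by rewrite -expr2 sqr_sqrtr ?ler0n.
by rewrite mulrACA sq [X in _ + X]mulrACA sq -mulrDr.
Qed.
End Tau.

(** * Each of the five conditions compared with [kernel_vertical] *)

Section PhaseRetrieval.
Variables (R : realType) (n r m : nat).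
Local Notation C := R[i].

(** The quadratic form of a Gram matrix at [x] is the sum of the squares of the pairings, so it
    vanishes only if each pairing does. *)
Lemma gram_mul_eq0 N (v : 'I_m -> 'cV[R]_N) (x : 'cV[R]_N) :
  (\sum_j v j *m (v j)^T) *m x = 0 <-> forall j, ((v j)^T *m x) 0 0 = 0.
Proof.
split=> [Qx0 j|h].
  have : (x^T *m ((\sum_j v j *m (v j)^T) *m x)) 0 0 = 0.
    by rewrite Qx0 mulmx0 mxE.
  rewrite mulmx_suml mulmx_sumr summxE => /eqP.
  have e i : (x^T *m (v i *m (v i)^T *m x)) 0 0 = (((v i)^T *m x) 0 0) ^+ 2.
    rewrite -mulmxA mulmxA mxE big_ord1 expr2; congr (_ * _).
    by rewrite -[v i in LHS]trmxK -trmx_mul mxE.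
  under eq_bigr do rewrite e.
  rewrite psumr_eq0; last by move=> i _; exact: sqr_ge0.
  by move=> /allP /(_ j (mem_index_enum _)) /=; rewrite sqrf_eq0 => /eqP.
rewrite mulmx_suml big1 // => j _; rewrite -mulmxA.
suff -> : (v j)^T *m x = 0 by rewrite mulmx0.
by apply/matrixP => a b; rewrite (ord1 a) (ord1 b) h mxE.
Qed.

Lemma unitmx_cVP N (Q : 'M[R]_N) :
  Q \in unitmx <-> forall x : 'cV[R]_N, Q *m x = 0 -> x = 0.
Proof.
split=> [Qu x Qx|h]; first by rewrite -(mulKmx Qu x) Qx mulmx0.
rewrite -unitmx_tr -row_free_unit; apply: inj_row_free => v vQ.
by apply: trmx_inj; rewrite trmx0; apply: h; rewrite -[Q]trmxK -trmx_mul vQ trmx0.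
Qed.

Variable A : 'I_m -> 'M[C]_n.
Hypothesis hA : forall j, is_hermitian (A j).

(* A direction [w] at [z] along which every measurement is stationary is tangent
   to the orbit [z U(r)]. *)
Definition kernel_vertical := forall z w : 'M[C]_(n, r), adj z *m z = 1%:M ->
  (forall j, ipR (A j *m z) w = 0) ->
  exists K : 'M[C]_r, skew_hermitian K /\ w = z *m K.

Lemma ipR_herm_swap j (z w : 'M[C]_(n, r)) : ipR (A j *m z) w = ipR (A j *m w) z.
Proof. by rewrite ipR_adjl hA ipRC. Qed.

Lemma beta_ipR (x : 'M[C]_(n, r)) j : beta A x j = ipR (A j *m x) x.
Proof. by rewrite /beta /ipR adjM hA mxtrace_mulC mulmxA. Qed.

Lemma beta_polarization (z w : 'M[C]_(n, r)) j :
  beta A (z + w) j - beta A (z - w) j = 4 * ipR (A j *m z) w.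
Proof.
rewrite !beta_ipR mulmxDr mulmxDr mulmxN !(ipRDl, ipRDr, ipRNl, ipRNr).
by rewrite [ipR (_ *m w) z]ipR_herm_swap; ring.
Qed.

Lemma outer_polarization (z w : 'M[C]_(n, r)) :
  (z + w) *m adj (z + w) - (z - w) *m adj (z - w) =
  (z *m adj w + w *m adj z) *+ 2.
Proof.
rewrite !adjD adjN !mulmxDl !mulmxDr !mulNmx !mulmxN opprK.
move: (z *m adj z) (z *m adj w) (w *m adj z) (w *m adj w) => a b c d.
by apply/matrixP => i j; rewrite !mxE; ring.
Qed.

Lemma kernel_vertical_full_rank (z w : 'M[C]_(n, r)) : (r <= n)%N ->
  kernel_vertical -> \rank z = r -> (forall j, ipR (A j *m z) w = 0) ->
  z *m adj w + w *m adj z = 0.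
Proof.
move=> hrn kv rz; have [U [P [UU Pu ->]]] := unitary_factor hrn rz => h.
have [|K [hK eK]] := kv U (w *m adj P) UU.
  by move=> j; rewrite ipR_adjr adjK -mulmxA.
have eP : P *m adj w = adj (w *m adj P) by rewrite adjM adjK.
rewrite -mulmxA eP (adjM U P) mulmxA eK adjM hK.
by rewrite mulNmx mulmxN mulmxA addNr.
Qed.

Lemma retrievableP : (r <= n)%N -> gen_phase_retrievable r A <-> kernel_vertical.
Proof.
move=> hrn; split=> [pr z w zz h|kv x y hxy].
  have : (z *m adj w + w *m adj z) *+ 2 = 0.
    rewrite -outer_polarization; apply/eqP; rewrite subr_eq0; apply/eqP.
    by apply: pr => j; apply/eqP; rewrite -subr_eq0 beta_polarization h mulr0.
  move=> /eqP; rewrite -scaler_nat scaler_eq0 pnatr_eq0 /= => /eqP e0.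
  (* Multiplying [z w^* + w z^* = 0] on the right by [z] gives [w = - z w^* z]; multiplying also on
     the left by [z^*] shows that this [K] is skew. *)
  exists (- (adj w *m z)); split.
    have : adj z *m (z *m adj w + w *m adj z) *m z = 0 by rewrite e0 mulmx0 mul0mx.
    rewrite mulmxDr mulmxDl !mulmxA zz mul1mx -!mulmxA zz mulmx1 => /eqP.
    rewrite addrC addr_eq0 => /eqP e.
    by rewrite /skew_hermitian adjN adjM adjK e.
  have : (z *m adj w + w *m adj z) *m z = 0 by rewrite e0 mul0mx.
  rewrite mulmxDl -!mulmxA zz mulmx1 addrC => /eqP; rewrite addr_eq0 => /eqP ew.
  by rewrite mulmxN.
pose u := rC 2^-1 *: (x + y); pose v := rC 2^-1 *: (x - y).
have ex : x = u + v by rewrite -scalerDr addrACA subrr addr0 rC_half_add.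
have ey : y = u - v.
  by rewrite -scalerBr opprB [x + y]addrC addrACA subrr addr0 rC_half_add.
have [z [w [rz e]]] := full_rank_cofactor u v hrn.
have e' : v *m adj u = w *m adj z by rewrite -[v]adjK -adjM e adjM adjK.
apply/eqP; rewrite -subr_eq0 ex ey outer_polarization e e'.
rewrite (kernel_vertical_full_rank hrn kv rz) ?mul0rn // => j.
have := beta_polarization u v j; rewrite -ex -ey hxy subrr => /esym/eqP.
rewrite mulf_eq0 pnatr_eq0 /= => /eqP <-.
(* The pairing depends on [X] and [Y] only through [X *m adj Y], so replacing [u, v] by [z, w] keeps
   it zero. *)
have eT X Y : ipR (A j *m X) Y = complex.Re (\tr (A j *m (X *m adj Y))).
  by rewrite ipRC /ipR mxtrace_mulC mulmxA.
by rewrite !eT e.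
Qed.

Lemma hatQ_kernelP : (forall z : 'M[C]_(n, r), adj z *m z = 1%:M ->
    forall x : 'cV[R]_(r * (n + n)), hatQ A z *m x = 0 <->
      exists K : 'M[C]_r, skew_hermitian K /\ x = mu (z *m K)) <->
  kernel_vertical.
Proof.
have hatE (z w : 'M[C]_(n, r)) :
    hatQ A z *m mu w = 0 <-> forall j, ipR (A j *m z) w = 0.
  have -> : hatQ A z = (4 : R) *: \sum_j mu (A j *m z) *m (mu (A j *m z))^T.
    (* Since [jmat (A j)] is symmetric, each summand is the outer square of [mu (A j *m z)]. *)
    congr (_ *: _); apply: eq_bigr => j _; rewrite -tens1_jmat_mu trmx_mul.
    by rewrite trmx_tens trmx1 jmat_herm // !mulmxA.
  rewrite -scalemxAl; split=> [/eqP|h].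
    rewrite scaler_eq0 pnatr_eq0 /= => /eqP /gram_mul_eq0 h j.
    by rewrite -mu_dot h.
  by rewrite (gram_mul_eq0 _ _).2 ?scaler0 // => j; rewrite mu_dot.
split=> [h z w zz /hatE /(h z zz)[K [hK /mu_inj ->]]|kv z zz x].
  by exists K.
have [w <-] := mu_surj x; split=> [/hatE hw|[K [hK ->]]].
  by have [K [hK ->]] := kv z w zz hw; exists K.
by apply/hatE => j; exact: ipR_vertical.
Qed.

(* Subtracting the vertical component [z K], [K] the skew part of [z^* w],
   leaves a vector whose pairing with [w] is its own squared norm. *)
Lemma vertical_projection (z w : 'M[C]_(n, r)) : adj z *m z = 1%:M ->
  let p := w - z *m skew_part (adj z *m w) in
  [/\ adj z *m p = herm_part (adj z *m w),
      forall K, skew_hermitian K -> ipR (z *m K) p = 0 &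
      ipR p w = 0 -> w = z *m skew_part (adj z *m w)].
Proof.
move=> zz p; have zp : adj z *m p = herm_part (adj z *m w).
  by rewrite mulmxBr mulmxA zz mul1mx -{1}(herm_skew_part (adj z *m w)) addrK.
have op K : skew_hermitian K -> ipR (z *m K) p = 0.
  by move=> hK; rewrite ipR_adjl zp ipRC ipR_herm_skew //; exact: herm_partP.
split=> // pw; apply/eqP; rewrite -subr_eq0; apply/eqP/ipR_eq0.
by rewrite ipRDr ipRNr -/p pw [ipR p _]ipRC op ?subrr //; exact: skew_partP.
Qed.

Lemma spanP : (forall U1 : 'M[C]_(n, r), adj U1 *m U1 = 1%:M ->
    forall X : 'M[C]_(n, r),
      (exists c : 'I_m -> R, X = \sum_j rC (c j) *: (A j *m U1)) <->
      (forall K : 'M[C]_r, skew_hermitian K -> ipR (U1 *m K) X = 0)) <->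
  kernel_vertical.
Proof.
split=> [h z w zz hw|kv z zz X].
  have [_ op ow] := vertical_projection w zz.
  exists (skew_part (adj z *m w)); split; first exact: skew_partP.
  (* The projection is orthogonal to all vertical directions, so (v) puts it in the span of the
     [A j *m z], each of which is orthogonal to [w]. *)
  apply: ow; have [c ->] := (h z zz _).2 op.
  by rewrite ipR_suml big1 // => j _; rewrite ipRZl hw mulr0.
split=> [[c ->] K hK|hX].
  by rewrite ipRC ipR_suml big1 // => j _; rewrite ipRZl ipR_vertical ?mulr0.
apply: span_double_orthogonal => w hw; have [K [hK ->]] := kv z w zz hw.
by rewrite ipRC hX.
Qed.

Lemma unitary_pairP (U1 : 'M[C]_(n, r)) (U2 : 'M[C]_(n, n - r)) :
  unitary_pair U1 U2 ->
  [/\ adj U1 *m U1 = 1%:M, adj U2 *m U2 = 1%:M, adj U1 *m U2 = 0,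
      adj U2 *m U1 = 0 & U1 *m adj U1 + U2 *m adj U2 = 1%:M].
Proof.
rewrite /unitary_pair adj_row mul_row_col mul_col_row => -[].
by rewrite scalar_mx_block => /eq_block_mx[-> -> -> ->] ->.
Qed.

Lemma combination_mul (c : 'I_m -> R) (U : 'M[C]_(n, r)) s (V : 'M[C]_(n, s)) :
  adj V *m (\sum_j rC (c j) *: A j) *m U =
  adj V *m (\sum_j rC (c j) *: (A j *m U)).
Proof.
rewrite -mulmxA mulmx_suml; congr (_ *m _); apply: eq_bigr => j _.
by rewrite scalemxAl.
Qed.

Lemma interpolationP : (forall (U1 : 'M[C]_(n, r)) (U2 : 'M[C]_(n, n - r)),
    unitary_pair U1 U2 ->
    forall (H : 'M[C]_r) (B : 'M[C]_(n - r, r)), is_hermitian H ->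
    exists c : 'I_m -> R,
      adj U1 *m (\sum_j rC (c j) *: A j) *m U1 = H /\
      adj U2 *m (\sum_j rC (c j) *: A j) *m U1 = B) <->
  kernel_vertical.
Proof.
split=> [h z w zz hw|/spanP kv U1 U2 hU H B hH].
  have [U2 hU] := unitary_complete zz; have [_ _ _ U21 U12] := unitary_pairP hU.
  have [zp _ ow] := vertical_projection w zz.
  exists (skew_part (adj z *m w)); split; first exact: skew_partP.
  apply: ow; set p := w - _ in zp *.
  (* The targets are the two coordinate blocks of [p] in the unitary frame [[z | U2]], so the
     interpolating combination reproduces [p] itself. *)
  have [c [e1 e2]] := h z U2 hU _ (adj U2 *m p) (herm_partP (adj z *m w)).
  rewrite -zp combination_mul in e1; rewrite combination_mul in e2.
  have -> : p = \sum_j rC (c j) *: (A j *m z).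
    by rewrite -[LHS]mul1mx -[RHS]mul1mx -U12 !mulmxDl -!mulmxA e1 e2.
  by rewrite ipR_suml big1 // => j _; rewrite ipRZl hw mulr0.
have [U11 U22 U12 U21 _] := unitary_pairP hU.
(* The matrix with blocks [H] and [B] is orthogonal to the vertical space because [H] is
   Hermitian. *)
have [|c e] := (kv U1 U11 (U1 *m H + U2 *m B)).2.
  move=> K hK; rewrite ipR_adjl mulmxDr !mulmxA U11 U12 mul1mx mul0mx addr0 ipRC.
  exact: ipR_herm_skew.
exists c; rewrite !combination_mul -e !mulmxDr !mulmxA U11 U12 U21 U22.
by rewrite !mul1mx !mul0mx addr0 add0r.
Qed.

Lemma QmatP : (forall (U1 : 'M[C]_(n, r)) (U2 : 'M[C]_(n, n - r)),
    unitary_pair U1 U2 -> Qmat A U1 U2 \in unitmx) <-> kernel_vertical.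
Proof.
(* [tau H] and [mu B] are isometric coordinates of [U1 H + U2 B], so the kernel of [Qmat] consists
   of the stationary directions without vertical component. *)
have QE (U1 : 'M[C]_(n, r)) (U2 : 'M[C]_(n, n - r)) H B : is_hermitian H ->
    Qmat A U1 U2 *m col_mx (tau H) (mu B) = 0 <->
    forall j, ipR (A j *m U1) (U1 *m H + U2 *m B) = 0.
  move=> hH; rewrite gram_mul_eq0.
  have e j : ((col_mx (tau (adj U1 *m A j *m U1)) (mu (adj U2 *m A j *m U1)))^T
      *m col_mx (tau H) (mu B)) 0 0 = ipR (A j *m U1) (U1 *m H + U2 *m B).
    rewrite tr_col_mx mul_row_col mxE tau_dot ?mu_dot //; last exact: hermitian_congr.
    by rewrite ipRDr -!mulmxA !ipR_adjl !adjK.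
  by split=> h j; move: (h j); rewrite e.
split=> [h z w zz hw|kv U1 U2 hU].
  have [U2 hU] := unitary_complete zz; have [_ _ _ U21 U12] := unitary_pairP hU.
  have [zp _ _] := vertical_projection w zz; set p := w - _ in zp *.
  exists (skew_part (adj z *m w)); split; first exact: skew_partP.
  have ep : p = z *m herm_part (adj z *m w) + U2 *m (adj U2 *m p).
    by rewrite -{1}[p]mul1mx -U12 mulmxDl -!mulmxA zp.
  have /QE : forall j, ipR (A j *m z) (z *m herm_part (adj z *m w) + U2 *m (adj U2 *m p)) = 0.
    move=> j; rewrite -ep ipRDr hw ipRNr ipR_vertical ?subrr //.
    exact: skew_partP.
  move=> /(_ (herm_partP _)) /(unitmx_cVP _).1 e.
  have /eq_col_mx[] : col_mx (tau (herm_part (adj z *m w))) (mu (adj U2 *m p)) =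
    col_mx 0 0 by rewrite col_mx0; apply: e; exact: h.
  move=> t0; rewrite -(mu0 R _ _) => /mu_inj B0.
  have H0 : herm_part (adj z *m w) = 0.
    apply: ipR_eq0; rewrite -tau_dot ?t0 ?mulmx0 ?mxE //; exact: herm_partP.
  by apply/eqP; rewrite -subr_eq0 -/p ep H0 B0 !mulmx0 addr0.
apply/unitmx_cVP => x; rewrite -[x]vsubmxK.
have [H [hH <-]] := tau_surj (usubmx x); have [B <-] := mu_surj (dsubmx x).
move=> /(QE _ _ _ _ hH) hw; have [U11 U22 U12 U21 _] := unitary_pairP hU.
have [K [hK eK]] := kv _ _ U11 hw.
(* Comparing [U1] blocks makes [H] both Hermitian and skew, hence zero; the [U2] block gives
   [B = 0]. *)
have eHK : H = K.
  have := congr1 (mulmx (adj U1)) eK.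
  by rewrite mulmxDr !mulmxA U11 U12 !mul1mx mul0mx addr0.
have H0 : H = 0.
  by apply: ipR_eq0; rewrite {2}eHK; exact: ipR_herm_skew.
have B0 : B = 0.
  have := congr1 (mulmx (adj U2)) eK.
  by rewrite mulmxDr !mulmxA U21 U22 mul1mx !mul0mx add0r.
have -> : tau H = 0.
  have := tau_dot hH hH; rewrite H0 ipR0l mxE => /eqP.
  rewrite psumr_eq0; last by move=> i _; rewrite mxE -expr2 sqr_ge0.
  move=> /allP h; apply/colP => i; move: (h i (mem_index_enum _)).
  by rewrite /= [_^T _ _]mxE mulf_eq0 orbb [RHS]mxE => /eqP.
by rewrite B0 mu0 col_mx0.
Qed.
End PhaseRetrieval.

Theorem theorem4p14 (R : realType) (n r m : nat) (hr1 : (1 <= r)%N) (hrn : (r <= n)%N)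
  (A : 'I_m -> 'M[R[i]]_n) (hA : forall j, is_hermitian (A j)) (hF : is_frame r A) :
  [<->
    (* (i) *)
    gen_phase_retrievable r A;
    (* (ii) *)
    (forall (U1 : 'M[R[i]]_(n, r)) (U2 : 'M[R[i]]_(n, n - r)),
       unitary_pair U1 U2 -> Qmat A U1 U2 \in unitmx);
    (* (iii) *)
    (forall z : 'M[R[i]]_(n, r), adj z *m z = 1%:M ->
       forall x : 'cV[R]_(r * (n + n)),
         hatQ A z *m x = 0 <->
         exists K : 'M[R[i]]_r, skew_hermitian K /\ x = mu (z *m K));
    (* (iv) *)
    (forall (U1 : 'M[R[i]]_(n, r)) (U2 : 'M[R[i]]_(n, n - r)),
       unitary_pair U1 U2 ->
       forall (H : 'M[R[i]]_r) (B : 'M[R[i]]_(n - r, r)), is_hermitian H ->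
       exists c : 'I_m -> R,
         adj U1 *m (\sum_j rC (c j) *: A j) *m U1 = H /\
         adj U2 *m (\sum_j rC (c j) *: A j) *m U1 = B);
    (* (v) *)
    (forall U1 : 'M[R[i]]_(n, r), adj U1 *m U1 = 1%:M ->
       forall X : 'M[R[i]]_(n, r),
         (exists c : 'I_m -> R, X = \sum_j rC (c j) *: (A j *m U1)) <->
         (forall K : 'M[R[i]]_r, skew_hermitian K -> ipR (U1 *m K) X = 0))
  ].
Proof.
(* Every arrow of the cycle passes through [kernel_vertical]. *)
have iP := @retrievableP R n r m A hA hrn.
have iiP := @QmatP R n r m A hA.
have iiiP := @hatQ_kernelP R n r m A hA.
have ivP := @interpolationP R n r m A hA.
have vP := @spanP R n r m A hA.
tfae.
- by move=> /iP /iiP.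
- by move=> /iiP /iiiP.
- by move=> /iiiP /ivP.
- by move=> /ivP /vP.
- by move=> /vP /iP.
Qed.
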